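(* Let $T=(V,E)$ be a combinatorial tree with $n=|V|\ge 2$ and let $\{i,j\}\in E$. Fix $\alpha\in[0,1)$. Assume that $$\frac{1}{\mathrm{d}(i)}+\frac{1}{\mathrm{d}(j)}\le \frac{1}{1-\alpha}$$ (for example, $\alpha\ge \frac12$ suffices). Then the Ollivier-Ricci curvature $\kappa^{\mathsf{or},\alpha}_{ij}$, the Lin-Lu-Yau curvature $\kappa^{\mathsf{lly}}_{ij}$ and the Steinerberger curvature $\kappa^{\mathsf{s}}$ satisfy $$\kappa^{\mathsf{or},\alpha}_{ij}=(1-\alpha)\,\kappa^{\mathsf{lly}}_{ij}=(1-\alpha)\,\frac{n-1}{n}\left(\frac{\kappa^{\mathsf{s}}_i}{\mathrm{d}(i)}+\frac{\kappa^{\mathsf{s}}_j}{\mathrm{d}(j)}\right).$$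
   Context: A tree is a finite, simple, connected, acyclic graph; a combinatorial tree is a tree with all edge weights equal to one. Write $V=\{1,\dots,n\}$, $i\sim j$ if $\{i,j\}\in E$, and $\mathrm{d}(i)$ for the degree of $i$ (number of incident edges). $\Delta(i,j)$ is the shortest path distance (number of edges in a shortest path), and $\mathcal{D}\in\mathbb{R}^{n\times n}$ is the matrix with $\mathcal{D}_{ij}=\Delta(i,j)$. For $\alpha\in[0,1)$ and $i\in V$, the $\alpha$-lazy random walk measure $m_i^{(\alpha)}$ is the probability measure on $V$ with $m_i^{(\alpha)}(i)=\alpha$, $m_i^{(\alpha)}(x)=(1-\alpha)/\mathrm{d}(i)$ if $x\sim i$, and $m_i^{(\alpha)}(x)=0$ otherwise. For probability measures $\mu,\nu$ on $V$, the 1-Wasserstein distance is $$\mathsf{W}_1(\mu,\nu)=\inf\Big\{\sum_{i,j\in V}\pi_{ij}\Delta(i,j):\ \pi\in\mathbb{R}^{n\times n},\ \pi_{ij}\ge 0,\ \mathbf{1}^T\pi=\mu^T,\ \pi\mathbf{1}=\nu\Big\},$$ where $\mathbf 1$ is the all-ones vector. Ollivier-Ricci curvature: $\kappa^{\mathsf{or},\alpha}_{ij}=1-\mathsf{W}_1(m_i^{(\alpha)},m_j^{(\alpha)})/\Delta(i,j)$ for $i\ne j$. Lin-Lu-Yau curvature: $\kappa^{\mathsf{lly}}_{ij}=\lim_{\alpha\to1^-}\kappa^{\mathsf{or},\alpha}_{ij}/(1-\alpha)$. Steinerberger curvature: $\kappa^{\mathsf{s}}=\mathcal{D}^{+}(n\mathbf{1})\in\mathbb{R}^n$,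 with $\kappa^{\mathsf{s}}_i$ its $i$-th entry, where $\mathcal{D}^+$ is the Moore-Penrose inverse. *)

(* Defs.v *)
From HB Require Import structures.
From mathcomp Require Import all_boot all_order all_algebra.
From mathcomp Require Import all_classical all_reals all_analysis.

Set Implicit Arguments.
Unset Strict Implicit.
Unset Printing Implicit Defensive.

Import Order.TTheory GRing.Theory Num.Theory.
Import numFieldNormedType.Exports.

Local Open Scope classical_set_scope.
Local Open Scope ring_scope.

(* A graph on n vertices is its adjacency relation e : rel 'I_n. *)

Definition simple_graph (n : nat) (e : rel 'I_n) : Prop :=
  symmetric e /\ irreflexive e.

Definition connected_graph (n : nat) (e : rel 'I_n) : Prop :=
  forall x y : 'I_n, connect e x y.

(* A graph cycle visits at least three vertices; [:: x; y] with e x y is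
   already a ucycle of a symmetric relation. *)
Definition acyclic_graph (n : nat) (e : rel 'I_n) : Prop :=
  forall c : seq 'I_n, (2 < size c)%N -> ~ ucycle e c.

Definition is_tree (n : nat) (e : rel 'I_n) : Prop :=
  [/\ simple_graph e, connected_graph e & acyclic_graph e].

Definition degree (n : nat) (e : rel 'I_n) (i : 'I_n) : nat :=
  #|[pred x : 'I_n | e i x]|.

Definition walk_of_length (n : nat) (e : rel 'I_n) (i j : 'I_n) (k : nat) :
    bool :=
  [exists p : k.-tuple 'I_n, path e i p && (last i p == j)].

(* The least k < n such that some walk from i to j has k edges. If i and j are
   connected, a shortest walk is a path and has fewer than n edges; otherwise
   the value is n. *)
Definition graph_dist (n : nat) (e : rel 'I_n) (i j : 'I_n) : nat :=
  find (walk_of_length e i j) (iota 0 n).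

Definition dist_mx (R : realType) (n : nat) (e : rel 'I_n) : 'M[R]_n :=
  \matrix_(i, j) (graph_dist e i j)%:R.

Definition lazy_walk (R : realType) (n : nat) (e : rel 'I_n) (alpha : R)
    (i : 'I_n) : 'cV[R]_n :=
  \col_x (if x == i then alpha
          else if e i x then (1 - alpha) / (degree e i)%:R
          else 0).

Definition coupling (R : realType) (n : nat) (mu nu : 'cV[R]_n)
    (pi : 'M[R]_n) : Prop :=
  [/\ forall i j, 0 <= pi i j,
      (const_mx 1 : 'cV[R]_n)^T *m pi = mu^T
    & pi *m (const_mx 1 : 'cV[R]_n) = nu].

Definition wasserstein1 (R : realType) (n : nat) (e : rel 'I_n)
    (mu nu : 'cV[R]_n) : R :=
  inf [set c : R | exists2 pi : 'M[R]_n, coupling mu nu pi &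
         c = \sum_i \sum_j pi i j * (graph_dist e i j)%:R].

Definition ollivier_ricci (R : realType) (n : nat) (e : rel 'I_n) (alpha : R)
    (i j : 'I_n) : R :=
  1 - wasserstein1 e (lazy_walk e alpha i) (lazy_walk e alpha j)
      / (graph_dist e i j)%:R.

Definition lin_lu_yau_quotient (R : realType) (n : nat) (e : rel 'I_n)
    (i j : 'I_n) (a : R) : R :=
  ollivier_ricci e a i j / (1 - a).

Definition lin_lu_yau (R : realType) (n : nat) (e : rel 'I_n)
    (i j : 'I_n) : R :=
  lim (lin_lu_yau_quotient (R := R) e i j a @[a --> 1^'-]).

(* The four Penrose conditions. MathComp's pinvmx is only a partial inverse
   and need not satisfy the two symmetry conditions. *)
Definition is_moore_penrose (R : realType) (m n : nat) (A : 'M[R]_(m, n))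
    (X : 'M[R]_(n, m)) : Prop :=
  [/\ A *m X *m A = A, X *m A *m X = X,
      (A *m X)^T = A *m X & (X *m A)^T = X *m A].

(* Every real matrix has exactly one Moore-Penrose inverse, so the default
   value 0 is never used. *)
Definition moore_penrose (R : realType) (m n : nat) (A : 'M[R]_(m, n)) :
    'M[R]_(n, m) :=
  xget 0 [set X | is_moore_penrose A X].

Definition steinerberger (R : realType) (n : nat) (e : rel 'I_n) : 'cV[R]_n :=
  moore_penrose (dist_mx R e) *m const_mx n%:R.

(* Main.v *)
Require Import Defs.
From mathcomp Require Import all_boot all_order all_algebra.
From mathcomp Require Import all_classical all_reals all_analysis.
From mathcomp Require Import ring lra zify.

Set Implicit Arguments.
Unset Strict Implicit.
Unset Printing Implicit Defensive.

Import Order.TTheory GRing.Theory Num.Theory.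
Import numFieldNormedType.Exports.

Local Open Scope classical_set_scope.
Local Open Scope ring_scope.

(** All three curvatures are explicit functions of the degrees: writing [d] for
    the degree, the Ollivier-Ricci curvature of the edge [ij] is
    [2 (1 - alpha) (1 / d i + 1 / d j - 1)] under the laziness condition, and the
    Steinerberger curvature at [x] is [n / (n - 1) * (2 - d x)]. The theorem
    compares these formulas.

    The tree structure enters the metric estimates through one fact: seen from
    a vertex [y], any other vertex [x] has exactly one neighbour closer to [y]
    and all its other neighbours are one step further ([tree_dist_child],
    [sum_neighbours]). If two neighbours of [x] were at most as far from [y] as
    [x] is, then the geodesics from them to [y] would close up to a cycle
    through [x].

    For the Steinerberger side, the neighbour sum rule says that the Laplacian
    [L] and the distance matrix [D] satisfy [L D = tau 1^T - 2 I], where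
    [tau x = 2 - d x]. Summing the rule for the squared distances by parts gives
    [D tau = (n - 1) 1] ([dist_mx_degree_defect]). Hence [D] is invertible, with
    the inverse found by Graham and Lovasz ([dist_mx_inverse]); this inverse is
    also the Moore-Penrose inverse, and it sends [n 1] to [n / (n - 1) tau].

    For the transport side, let [pi] be a coupling of the walks at [i] and [j].
    Moving mass between [x] in the ball around [j] and [y] in the ball around
    [i] costs [dist x i + dist y j - 1], unless [x = i] and [y = j], where it
    costs two more ([tree_dist_across_edge]). So the cost of [pi] is a constant
    determined by the marginals plus [2 * pi i j] ([coupling_cost]). The
    Wasserstein distance is that constant as soon as some coupling vanishes at
    [(i, j)]. The mass available outside that cell makes this possible exactly
    when [(1 - alpha) / d i + (1 - alpha) / d j <= 1], which is the laziness
    condition ([coupling_avoiding_cell]). The condition holds for all [alpha]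
    near [1], so the quotient defining the Lin-Lu-Yau curvature is eventually
    constant, and its limit is that constant. *)

(** * Walks and graph distance *)

Lemma walk_of_lengthP (n : nat) (e : rel 'I_n) (x y : 'I_n) (k : nat) :
  reflect (exists p, [/\ path e x p, last x p = y & size p = k])
          (walk_of_length e x y k).
Proof.
apply: (iffP existsP) => [[p /andP[ep /eqP lp]]|[p [ep lp sp]]].
  by exists p; split=> //; rewrite size_tuple.
have sp' : size p == k by apply/eqP.
by exists (Tuple sp'); rewrite /= ep lp eqxx.
Qed.

Lemma graph_dist_le (n : nat) (e : rel 'I_n) (x : 'I_n) (p : seq 'I_n) :
  path e x p -> (graph_dist e x (last x p) <= size p)%N.
Proof.
move=> ep; rewrite /graph_dist.
have [le_n|lt_n] := leqP n (size p).
  by rewrite (leq_trans (find_size _ _)) // size_iota.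
rewrite leqNgt; apply/negP => /(before_find 0%N).
rewrite nth_iota // add0n => /walk_of_lengthP[].
by exists p.
Qed.

(** Cutting the loops out of a walk leaves one with fewer than [n] edges, so the
    bounded search in [graph_dist] succeeds. *)
Lemma geodesic_exists (n : nat) (e : rel 'I_n) (x y : 'I_n) :
  connect e x y ->
  exists p, [/\ path e x p, last x p = y & size p = graph_dist e x y].
Proof.
case/connectP=> p0 ep0 ->; case/shortenP: ep0 => p ep up _.
apply/walk_of_lengthP; rewrite /graph_dist.
have szp : (size p < n)%N.
  by have := max_card (mem (x :: p)); rewrite (card_uniqP up) card_ord.
have has_walk : has (walk_of_length e x (last x p)) (iota 0 n).
  apply/hasP; exists (size p); first by rewrite mem_iota.
  by apply/walk_of_lengthP; exists p.
have := nth_find 0%N has_walk.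
by rewrite nth_iota // -[X in (_ < X)%N](size_iota 0) -has_find.
Qed.

Lemma graph_distxx (n : nat) (e : rel 'I_n) (x : 'I_n) : graph_dist e x x = 0%N.
Proof. by apply/eqP; rewrite -leqn0 (@graph_dist_le _ _ x [::]). Qed.

Section Connected.

Variables (n : nat) (e : rel 'I_n).
Hypotheses (e_sym : symmetric e) (e_conn : connected_graph e).
Local Notation dist := (graph_dist e).

Lemma graph_dist_eq0 (x y : 'I_n) : (dist x y == 0%N) = (x == y).
Proof.
apply/eqP/eqP => [d0|->]; last exact: graph_distxx.
have [p [_ lp sp]] := geodesic_exists (e_conn x y).
by rewrite -lp; move: sp; rewrite d0 => /size0nil ->.
Qed.

Lemma graph_distC (x y : 'I_n) : dist x y = dist y x.
Proof.
wlog suff le : x y / (dist x y <= dist y x)%N.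
  by apply/eqP; rewrite eqn_leq !le.
have [p [ep <- <-]] := geodesic_exists (e_conn y x).
have := @graph_dist_le _ e (last y p) (rev (belast y p)).
rewrite rev_path size_rev size_belast.
rewrite (_ : path _ y p); last by rewrite (eq_path (e' := e)).
case/lastP: p {ep} => [|p z]; first exact.
by rewrite belast_rcons rev_cons !last_rcons; apply.
Qed.

Lemma graph_dist_edge (x y z : 'I_n) : e x z -> (dist x y <= (dist z y).+1)%N.
Proof.
move=> exz; have [p [ep lp sp]] := geodesic_exists (e_conn z y).
by rewrite -sp -lp (@graph_dist_le _ _ x (z :: p)) //= exz.
Qed.

Lemma geodesic_step (x y : 'I_n) :
  x != y -> exists2 z, e x z & dist x y = (dist z y).+1.
Proof.
rewrite -graph_dist_eq0.
have [[|z p] /= [ep lp sp]] := geodesic_exists (e_conn x y).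
  by rewrite -sp.
case/andP: ep => exz ep _; exists z => //; apply/eqP.
by rewrite eqn_leq graph_dist_edge // -sp ltnS -lp graph_dist_le.
Qed.

(** Distances to [y] strictly decrease along a geodesic towards [y], so such a
    geodesic never meets a vertex that is at least as far from [y] as its
    starting point. *)
Lemma connect_avoiding (x y z : 'I_n) :
  z != x -> (dist z y <= dist x y)%N ->
  connect [rel u v | [&& e u v, u != x & v != x]] z y.
Proof.
have [k] := ubnP (dist z y); elim: k z => // k IHk z lt_k zx le_zx.
have [->//|/geodesic_step[w ezw dw]] := eqVneq z y.
have wx : w != x by apply: contraTneq le_zx => <-; rewrite dw ltnn.
apply: (@connect_trans _ _ w); first by apply: connect1; rewrite /= ezw zx wx.
by apply: IHk => //; lia.
Qed.

End Connected.

(** * Distances in trees *)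

(** A detour between two neighbours of [x] that avoids [x] closes up through
    [x] to a cycle. *)
Lemma acyclic_neighbours_separated (n : nat) (e : rel 'I_n) (x z z' : 'I_n) :
  symmetric e -> acyclic_graph e -> e x z -> e x z' -> z != x ->
  connect [rel u v | [&& e u v, u != x & v != x]] z z' -> z = z'.
Proof.
move=> e_sym acy exz exz' zx /connectP[p0 ep0 def_z'].
move: exz'; rewrite {}def_z'.
case/shortenP: ep0 => p ep up _ exz'.
(* The detour is nonempty when the neighbours differ, which makes the cycle
   below long enough. *)
case: p ep up exz' => // w p ep up exz'.
case: (acy [:: x, z, w & p]) => //; rewrite /ucycle cons_uniq up.
have sub_e : subrel [rel u v | [&& e u v, u != x & v != x]] e.
  by move=> u v /= /andP[].
have epx : all (predC1 x) (w :: p).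
  elim: (w :: p) z ep {up zx exz exz'} => //= u q IHq z /andP[/and3P[_ _ ->]].
  exact: IHq.
have xp : x \notin w :: p by apply/negP => /(allP epx); rewrite /= eqxx.
rewrite inE eq_sym negb_or zx xp !andbT.
change (path e x (rcons [:: z, w & p] x)); rewrite rcons_path e_sym exz' andbT.
by apply/andP; split=> //; exact: sub_path ep.
Qed.

Section Tree.

Variables (n : nat) (e : rel 'I_n).
Hypothesis e_tree : is_tree e.
Local Notation dist := (graph_dist e).

Lemma tree_sym : symmetric e. Proof. by case: e_tree => [[]]. Qed.
Lemma tree_irr : irreflexive e. Proof. by case: e_tree => [[]]. Qed.
Lemma tree_conn : connected_graph e. Proof. by case: e_tree. Qed.

(** If two neighbours of [x] were both at most as far from [y] as [x] is,
    geodesics from them to [y] would join them without using [x]. *)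
Lemma tree_parent_unique (x y z z' : 'I_n) :
  e x z -> e x z' -> (dist z y <= dist x y)%N -> (dist z' y <= dist x y)%N ->
  z = z'.
Proof.
move=> exz exz' le_z le_z'.
have neq u : e x u -> u != x by apply: contraTneq => ->; rewrite tree_irr.
have csym : connect_sym [rel u v | [&& e u v, u != x & v != x]].
  apply: sym_connect_sym => u v /=; rewrite tree_sym.
  by rewrite [(u != x) && _]andbC.
have acy : acyclic_graph e by case: e_tree.
apply: (acyclic_neighbours_separated tree_sym acy exz exz' (neq _ exz)).
apply: connect_trans (connect_avoiding tree_conn (neq _ exz) le_z) _.
by rewrite csym (connect_avoiding tree_conn (neq _ exz') le_z').
Qed.

Lemma tree_dist_child (x y z w : 'I_n) :
  e x z -> e x w -> z != w -> (dist z y <= dist x y)%N ->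
  dist w y = (dist x y).+1.
Proof.
move=> exz exw zw le_z; apply/eqP; rewrite eqn_leq.
rewrite (graph_dist_edge tree_conn) 1?tree_sym // ltnNge.
by apply: contraNN zw => /(tree_parent_unique exz exw le_z) ->.
Qed.

Lemma tree_dist_edge (x y : 'I_n) : e x y -> dist x y = 1%N.
Proof.
move=> exy; apply/eqP; rewrite eqn_leq.
have := graph_dist_edge tree_conn y exy; rewrite graph_distxx => -> /=.
rewrite lt0n (graph_dist_eq0 tree_conn).
by apply: contraTneq exy => ->; rewrite tree_irr.
Qed.

(** Seen from [y], every other vertex has one parent, one step closer, and its
    remaining neighbours are children, one step further away. *)
Lemma sum_neighbours (V : nmodType) (g : nat -> V) (x y : 'I_n) :
  x != y ->
  \sum_(z | e x z) g (dist z y) =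
  g (dist x y).-1 + g (dist x y).+1 *+ (degree e x).-1.
Proof.
move=> /(geodesic_step tree_conn)[p exp dp].
rewrite (bigD1 p) //= dp /=; congr (_ + _).
rewrite (eq_bigr (fun=> g (dist x y).+1)); last first.
  by move=> z /andP[exz zp]; rewrite (tree_dist_child exp exz) 1?eq_sym // dp.
rewrite sumr_const dp; congr (_ *+ _).
rewrite /degree [in RHS](cardD1 p) [p \in _]exp /=; apply: eq_card => z.
by rewrite !inE andbC.
Qed.

Lemma sum_neighbours_root (V : nmodType) (g : nat -> V) (y : 'I_n) :
  \sum_(z | e y z) g (dist z y) = g 1%N *+ degree e y.
Proof.
rewrite (eq_bigr (fun=> g 1%N)) ?sumr_const // => z eyz.
by rewrite tree_dist_edge // tree_sym.
Qed.

Lemma degree_gt0 (x z : 'I_n) : e x z -> (0 < degree e x)%N.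
Proof. by move=> exz; apply/card_gt0P; exists z. Qed.

End Tree.

(** * The inverse of the distance matrix and the Steinerberger curvature *)

Section TreeDistanceMatrix.

Variables (R : realType) (n : nat) (e : rel 'I_n).
Hypothesis e_tree : is_tree e.
Local Notation dist := (graph_dist e).
Local Notation deg x := ((degree e x)%:R : R).

Lemma sum_adjacent (F : 'I_n -> R) (x : 'I_n) :
  \sum_(z | e x z) F z = \sum_z (e x z)%:R * F z.
Proof.
rewrite big_mkcond; apply: eq_bigr => z _.
by case: (e x z); rewrite ?mul1r ?mul0r.
Qed.

(** Summation by parts on the edges. *)
Lemma sum_neighbours_swap (F : 'I_n -> R) :
  \sum_x \sum_(z | e x z) F z = \sum_x deg x * F x.
Proof.
under eq_bigr do rewrite sum_adjacent.
rewrite exchange_big; apply: eq_bigr => z _ /=; rewrite -mulr_suml -natr_sum.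
suff -> : (\sum_(x < n) e x z = degree e z)%N by [].
rewrite /degree -sum1_card [RHS]big_mkcond /=.
by apply: eq_bigr => x _; rewrite (tree_sym e_tree) -topredE /=; case: (e _ _).
Qed.

(** For [x <> y] this is [(k - 1) + (d - 1) (k + 1)] with [k = dist x y] and
    [d] the degree of [x]; the root [x = y] has no parent, whence the
    correction by [2]. *)
Lemma sum_dist_neighbours (x y : 'I_n) :
  \sum_(z | e x z) (dist z y)%:R
  = deg x * (dist x y)%:R + deg x - 2 + 2 * (x == y)%:R.
Proof.
have [->|xy] := eqVneq x y.
  rewrite (sum_neighbours_root e_tree (fun k => k%:R)) graph_distxx /=.
  by ring.
rewrite (sum_neighbours e_tree (fun k => k%:R)) //.
have [z exz ->] := geodesic_step (tree_conn e_tree) xy.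
by case: (degree e x) (degree_gt0 exz) => // d _ /=; ring.
Qed.

(** Squaring removes the correction at the root, because the missing parent
    would sit at distance [-1], where the square is that of a child. *)
Lemma sum_dist2_neighbours (x y : 'I_n) :
  \sum_(z | e x z) (dist z y)%:R ^+ 2
  = deg x * (dist x y)%:R ^+ 2 + deg x - 2 * ((dist x y)%:R * (2 - deg x)).
Proof.
have [->|xy] := eqVneq x y.
  rewrite (sum_neighbours_root e_tree (fun k => k%:R ^+ 2)) graph_distxx /=.
  by ring.
rewrite (sum_neighbours e_tree (fun k => k%:R ^+ 2)) //.
have [z exz ->] := geodesic_step (tree_conn e_tree) xy.
by case: (degree e x) (degree_gt0 exz) => // d _ /=; ring.
Qed.

(** The handshake count of a tree comes out of the distances to any one vertex
    [y]: summing [sum_dist_neighbours] over [x], the distances cancel. *)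
Lemma sum_degree (y : 'I_n) : \sum_x deg x = 2 * (n%:R - 1).
Proof.
have := sum_neighbours_swap (fun z => (dist z y)%:R).
under eq_bigr do rewrite sum_dist_neighbours.
rewrite !big_split /= sumr_const card_ord -mulr_sumr [X in 2 * X](bigD1 y) //=.
rewrite eqxx [X in 1 + X]big1 => [|x /negPf -> //].
by rewrite mulNrn -mulr_natl; lra.
Qed.

Definition degree_defect : 'cV[R]_n := \col_x (2 - deg x).

(** Summing [sum_dist2_neighbours] over [x], summation by parts cancels the
    squares and leaves [2 * (D tau) y] equal to the sum of all degrees. *)
Lemma dist_mx_degree_defect :
  dist_mx R e *m degree_defect = const_mx (n%:R - 1).
Proof.
apply/matrixP => y k; rewrite !mxE.
have := sum_neighbours_swap (fun z => (dist z y)%:R ^+ 2).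
under eq_bigr do rewrite sum_dist2_neighbours.
rewrite !big_split /= sumrN -mulr_sumr (sum_degree y) => sq.
rewrite (eq_bigr (fun x => (dist x y)%:R * (2 - deg x))); first by lra.
by move=> x _; rewrite !mxE (graph_distC (tree_sym e_tree) (tree_conn e_tree)).
Qed.

Definition laplacian_mx : 'M[R]_n :=
  \matrix_(x, y) (deg x * (x == y)%:R - (e x y)%:R).

Lemma laplacian_dist_mx :
  laplacian_mx *m dist_mx R e = degree_defect *m (const_mx 1)^T - 2%:M.
Proof.
apply/matrixP => x y; rewrite !mxE big_ord_recl big_ord0 !mxE addr0 mulr1.
rewrite (eq_bigr (fun z => deg x * ((x == z)%:R * (dist z y)%:R)
                         - (e x z)%:R * (dist z y)%:R)); last first.
  by move=> z _; rewrite !mxE mulrBl mulrA.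
rewrite sumrB -mulr_sumr -sum_adjacent sum_dist_neighbours.
rewrite (bigD1 x) //= eqxx big1 => [|z zx]; last first.
  by rewrite eq_sym (negPf zx) mul0r.
by case: (x == y) => /=; ring.
Qed.

(** The Graham-Lovasz formula. With [L] and [tau] the matrices of
    [laplacian_dist_mx], the term [- L / 2] alone inverts [D] up to the rank one
    defect [tau 1^T / 2], and [tau tau^T D = (n - 1) tau 1^T] cancels it. *)
Lemma dist_mx_inverse :
  (1 < n)%N ->
  ((2 * (n%:R - 1))^-1 *: (degree_defect *m degree_defect^T)
   - 2^-1 *: laplacian_mx) *m dist_mx R e = 1%:M.
Proof.
move=> n1; have n1R : n%:R - 1 != 0 :> R.
  by rewrite subr_eq0 -[1]/(1%:R) eqr_nat gtn_eqF.
have dist_sym : (dist_mx R e)^T = dist_mx R e.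
  apply/matrixP => x y; rewrite !mxE.
  by rewrite (graph_distC (tree_sym e_tree) (tree_conn e_tree)).
rewrite mulmxBl -!scalemxAl laplacian_dist_mx -mulmxA.
rewrite -[in X in _ *m X]dist_sym -trmx_mul dist_mx_degree_defect.
rewrite -[n%:R - 1]mulr1 -scalemx_const linearZ /= -scalemxAr scalerA.
rewrite scalerBr -scalemx1 !scalerA mulr1 invfM -mulrA mulVf // mulr1.
by rewrite mulVf ?pnatr_eq0 // scale1r opprB addrC subrK.
Qed.

Lemma moore_penrose_left_inverse (A B : 'M[R]_n) :
  B *m A = 1%:M -> moore_penrose A = B.
Proof.
move=> BA; have AB := mulmx1C BA.
apply: xget_unique => [|X [AXA _ _ _]].
  by split; rewrite ?AB ?BA ?mul1mx ?trmx1.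
have : B *m (A *m X *m A) *m B = B *m A *m B by rewrite AXA.
by rewrite -!mulmxA AB !mulmx1 mulmxA BA mul1mx.
Qed.

Lemma steinerberger_tree (x : 'I_n) : (1 < n)%N ->
  steinerberger R e x 0 = n%:R / (n%:R - 1) * (2 - deg x).
Proof.
move=> n1; have n1R : n%:R - 1 != 0 :> R.
  by rewrite subr_eq0 -[1]/(1%:R) eqr_nat gtn_eqF.
rewrite /steinerberger (moore_penrose_left_inverse (dist_mx_inverse n1)).
set B := (X in X *m _).
have -> : const_mx n%:R = n%:R / (n%:R - 1) *: (dist_mx R e *m degree_defect).
  by rewrite dist_mx_degree_defect scalemx_const divfK.
by rewrite -scalemxAr mulmxA dist_mx_inverse // mul1mx !mxE.
Qed.

End TreeDistanceMatrix.

(** * Couplings *)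

Section Couplings.

Variables (R : realType) (n : nat).
Implicit Types (mu nu : 'cV[R]_n) (pi : 'M[R]_n).

Lemma couplingP mu nu pi :
  coupling mu nu pi <->
  [/\ forall x y, 0 <= pi x y, forall y, \sum_x pi x y = mu y 0
    & forall x, \sum_y pi x y = nu x 0].
Proof.
split=> -[pi0 col row]; split=> //.
- move=> y; have /matrixP/(_ 0 y) := col; rewrite !mxE => <-.
  by apply: eq_bigr => x _; rewrite !mxE mul1r.
- move=> x; rewrite -row mxE.
  by apply: eq_bigr => y _; rewrite mxE mulr1.
- apply/matrixP => k y; rewrite !mxE ord1 -col.
  by apply: eq_bigr => x _; rewrite !mxE mul1r.
- apply/matrixP => x k; rewrite !mxE ord1 -row.
  by apply: eq_bigr => y _; rewrite !mxE mulr1.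
Qed.

Lemma coupling_support mu nu pi x y :
  coupling mu nu pi -> pi x y != 0 -> mu y 0 != 0 /\ nu x 0 != 0.
Proof.
case/couplingP=> pi0 col row pixy; split; apply: contraNneq pixy.
  by rewrite -col => /psumr_eq0P ->.
by rewrite -row => /psumr_eq0P ->.
Qed.

Lemma sum_singled_out mu j a b :
  \sum_y mu y 0 = 1 ->
  \sum_y mu y 0 * (if y == j then a else b) = mu j 0 * a + (1 - mu j 0) * b.
Proof.
move=> <-; rewrite (bigD1 j) //= eqxx; congr (_ + _).
rewrite [in RHS](bigD1 j) //= [mu j 0 + _]addrC addrK mulr_suml.
by apply: eq_bigr => y /negPf ->.
Qed.

(** A coupling can leave the cell [(i, j)] empty as soon as the masses of row
    [i] and of column [j] fit side by side. The witness is the product measure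
    with that cell removed and the rest of row [i], the rest of column [j] and
    the remaining block each rescaled by a constant to restore the marginals;
    the block keeps total mass [1 - nu i - mu j], which must not be negative. *)
Lemma coupling_avoiding_cell mu nu (i j : 'I_n) :
  (forall y, 0 <= mu y 0) -> (forall x, 0 <= nu x 0) ->
  \sum_y mu y 0 = 1 -> \sum_x nu x 0 = 1 ->
  mu j 0 < 1 -> nu i 0 < 1 -> nu i 0 + mu j 0 <= 1 ->
  exists2 pi, coupling mu nu pi & pi i j = 0.
Proof.
move=> mu0 nu0 mu1 nu1 ltp ltq le1.
set p := mu j 0 in ltp le1; set q := nu i 0 in ltq le1.
have p1 : 0 < 1 - p by rewrite subr_gt0.
have q1 : 0 < 1 - q by rewrite subr_gt0.
pose c := (1 - q - p) / ((1 - q) * (1 - p)).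
pose K (r s : bool) :=
  if r then (if s then 0 else (1 - p)^-1) else (if s then (1 - q)^-1 else c).
have K0 r s : 0 <= K r s.
  have c0 : 0 <= c by apply: divr_ge0; [lra|rewrite mulr_ge0 ?ltW].
  by rewrite /K; case: r; case: s; rewrite // invr_ge0 ltW.
exists (\matrix_(x, y) (nu x 0 * mu y 0 * K (x == i) (y == j))); last first.
  by rewrite mxE !eqxx mulr0.
apply/couplingP; split=> [x y|y|x].
- by rewrite mxE !mulr_ge0.
- under eq_bigr do rewrite mxE mulrAC.
  have KE x : K (x == i) (y == j)
    = if x == i then K true (y == j) else K false (y == j) by case: eqP.
  under eq_bigr do rewrite KE.
  rewrite -mulr_suml (sum_singled_out i _ _ nu1) -/q.
  case: eqP => [->|_] /=; rewrite /c -/p; field.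
    by rewrite gt_eqF.
  by rewrite !gt_eqF.
- under eq_bigr do rewrite mxE -mulrA.
  have KE y : K (x == i) (y == j)
    = if y == j then K (x == i) true else K (x == i) false by case: (y == j).
  under eq_bigr do rewrite KE.
  rewrite -mulr_sumr (sum_singled_out j _ _ mu1) -/p.
  case: eqP => [->|_] /=; rewrite /c -/q; field.
    by rewrite gt_eqF.
  by rewrite !gt_eqF.
Qed.

End Couplings.

(** * Transport between lazy random walks *)

Section LazyWalks.

Variables (R : realType) (n : nat) (e : rel 'I_n).
Hypothesis e_tree : is_tree e.
Local Notation dist := (graph_dist e).
Local Notation deg x := ((degree e x)%:R : R).

Lemma sum_lazy_walk (F : 'I_n -> R) (a : R) (i : 'I_n) :
  \sum_x lazy_walk e a i x 0 * F x
  = a * F i + (1 - a) / deg i * \sum_(x | e i x) F x.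
Proof.
rewrite (bigD1 i) //= mxE eqxx; congr (_ + _).
rewrite mulr_sumr [LHS]big_mkcond [RHS]big_mkcond; apply: eq_bigr => x _ /=.
rewrite mxE; have [->|_] := eqVneq x i; first by rewrite (tree_irr e_tree).
by case: (e i x); rewrite ?mul0r.
Qed.

Lemma lazy_walk_ge0 (a : R) (i x : 'I_n) :
  0 <= a <= 1 -> 0 <= lazy_walk e a i x 0.
Proof.
case/andP=> a0 a1; rewrite mxE; case: ifP => // _; case: ifP => // _.
by rewrite divr_ge0 // subr_ge0.
Qed.

Lemma lazy_walk_total (a : R) (i j : 'I_n) :
  e i j -> \sum_x lazy_walk e a i x 0 = 1.
Proof.
move=> eij; under eq_bigr do rewrite -[lazy_walk _ _ _ _ _]mulr1.
rewrite sum_lazy_walk sumr_const -/(degree e i) mulr1 divfK; first by ring.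
by rewrite pnatr_eq0 -lt0n (degree_gt0 eij).
Qed.

Lemma lazy_walk_support (a : R) (i x : 'I_n) :
  lazy_walk e a i x 0 != 0 -> x = i \/ e i x.
Proof.
rewrite mxE; case: (eqVneq x i) => [->|_]; first by left.
by case: (e i x); [right|rewrite eqxx].
Qed.

Lemma lazy_walk_edge (a : R) (i j : 'I_n) :
  e i j -> lazy_walk e a i j 0 = (1 - a) / deg i.
Proof.
move=> eij; rewrite mxE eij; case: eqVneq => // ji.
by move: eij; rewrite ji (tree_irr e_tree).
Qed.

(** For [x] beyond [j] and [y] beyond [i], the geodesics from [x] to [i] and
    from [y] to [j] overlap exactly in the edge [ij], and together they form the
    geodesic from [x] to [y]. For [x = i] and [y = j] both are empty, and the
    count [0 + 0 - 1] falls short of [dist i j] by two. *)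
Lemma tree_dist_across_edge (i j x y : 'I_n) :
  e i j -> x = j \/ e j x -> y = i \/ e i y ->
  (dist x y + 1 = dist x i + dist y j + 2 * ((x == i) && (y == j)))%N.
Proof.
move=> eij.
have distC := graph_distC (tree_sym e_tree) (tree_conn e_tree).
have eji : e j i by rewrite (tree_sym e_tree).
have dij := tree_dist_edge e_tree eij; have dji := tree_dist_edge e_tree eji.
have neq_ij : (i == j) = false.
  by apply/eqP => ij; move: eij; rewrite ij (tree_irr e_tree).
case=> [->|ejx] [->|eiy].
- by rewrite eq_sym neq_ij dij dji.
- by rewrite eq_sym neq_ij dji distC; lia.
- by rewrite neq_ij andbF dij; lia.
have dyj : j != y -> dist y j = 2%N.
  move=> jy; rewrite (tree_dist_child e_tree eij eiy jy) ?dij //.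
  by rewrite graph_distxx.
have dxi : i != x -> dist x i = 2%N.
  move=> ix; rewrite (tree_dist_child e_tree eji ejx ix) ?dji //.
  by rewrite graph_distxx.
have dxj : dist x j = 1%N by rewrite distC (tree_dist_edge e_tree ejx).
have diy : dist i y = 1%N by rewrite (tree_dist_edge e_tree eiy).
have [xi|xi] := eqVneq x i; have [yj|yj] := eqVneq y j.
- by rewrite xi yj dij !graph_distxx.
- by rewrite xi diy graph_distxx dyj // eq_sym.
- by rewrite yj dxj graph_distxx dxi // eq_sym.
rewrite dyj 1?eq_sym // dxi 1?eq_sym //.
rewrite distC (tree_dist_child e_tree eij eiy (y := x)) 1?eq_sym //.
  by rewrite distC dxi // eq_sym.
by rewrite ![dist _ x]distC dxj dxi // eq_sym.
Qed.

(** A coupling only charges pairs [(x, y)] with [x] in the ball around [j] and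
    [y] in the ball around [i], so its cost can be summed with
    [tree_dist_across_edge], and the marginals determine all but the last
    term. *)
Lemma coupling_cost (a : R) (i j : 'I_n) (pi : 'M[R]_n) :
  e i j -> coupling (lazy_walk e a i) (lazy_walk e a j) pi ->
  \sum_x \sum_y pi x y * (dist x y)%:R =
  \sum_x lazy_walk e a j x 0 * (dist x i)%:R
  + \sum_y lazy_walk e a i y 0 * (dist y j)%:R - 1 + 2 * pi i j.
Proof.
move=> eij cpi; have [_ col row] := (couplingP _ _ _).1 cpi.
have cell x y : pi x y * (dist x y)%:R =
    pi x y * (dist x i)%:R + pi x y * (dist y j)%:R - pi x y
    + (if x == i then (if y == j then 2 * pi i j else 0) else 0).
  have [pi0|/(coupling_support cpi)[mu_y nu_x]] := eqVneq (pi x y) 0.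
    rewrite pi0 !mul0r addr0 subr0 add0r.
    by case: eqP => // xi; case: eqP => // yj; rewrite -xi -yj pi0 mulr0.
  have := tree_dist_across_edge eij (lazy_walk_support nu_x)
                                    (lazy_walk_support mu_y).
  move=> /(congr1 (fun k => k%:R : R)); rewrite !natrD => d.
  have -> : (if x == i then if y == j then 2 * pi i j else 0 else 0)
      = pi x y * (2 * ((x == i) && (y == j))%:R).
    case: eqP => [->|_] /=; last by rewrite !mulr0.
    by case: eqP => [->|_] /=; rewrite ?mulr0 // mulr1 mulrC.
  have -> : (dist x y)%:R = (dist x i)%:R + (dist y j)%:R - 1
      + 2 * ((x == i) && (y == j))%:R :> R by lra.
  ring.
under eq_bigr do under eq_bigr do rewrite cell.
under eq_bigr do rewrite !big_split /= sumrN row -mulr_suml row.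
rewrite !big_split /= sumrN exchange_big /=.
under [X in _ + X - _ + _]eq_bigr do rewrite -mulr_suml col.
have eji : e j i by rewrite (tree_sym e_tree).
rewrite (lazy_walk_total _ eji); congr (_ + _).
rewrite (bigD1 i) //= eqxx [X in _ + X]big1 ?addr0 => [|x /negPf xi].
  by rewrite (bigD1 j) //= eqxx big1 ?addr0 // => y /negPf ->.
by rewrite big1 // => y _; rewrite xi.
Qed.

Lemma lazy_walk_mean_dist (a : R) (i j : 'I_n) : e i j ->
  \sum_y lazy_walk e a i y 0 * (dist y j)%:R = 2 - a - 2 * (1 - a) / deg i.
Proof.
move=> eij; rewrite sum_lazy_walk sum_dist_neighbours //.
rewrite (tree_dist_edge e_tree eij).
have -> : (i == j) = false.
  by apply/eqP => ij; move: eij; rewrite ij (tree_irr e_tree).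
rewrite /= mulr0n; field.
by rewrite pnatr_eq0 -lt0n (degree_gt0 eij).
Qed.

(** By [coupling_cost] the optimal couplings are those that leave the cell
    [(i, j)] empty; the laziness condition provides one. *)
Lemma wasserstein1_lazy_walk (a : R) (i j : 'I_n) :
  e i j -> 0 <= a < 1 -> (deg i)^-1 + (deg j)^-1 <= (1 - a)^-1 ->
  wasserstein1 e (lazy_walk e a i) (lazy_walk e a j)
  = 1 + 2 * (1 - a) * (1 - (deg i)^-1 - (deg j)^-1).
Proof.
move=> eij /andP[a0 a1] lazy.
have eji : e j i by rewrite (tree_sym e_tree).
have a_gt0 : 0 < 1 - a by rewrite subr_gt0.
have a01 : 0 <= a <= 1 by rewrite a0 ltW.
have mass_gt0 x y : e x y -> 0 < (1 - a) / deg x.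
  by move=> exy; rewrite divr_gt0 // ltr0n (degree_gt0 exy).
have mass_le1 : (1 - a) / deg j + (1 - a) / deg i <= 1.
  by rewrite -mulrDr -ler_pdivlMl // mulr1 addrC.
have cost pi : coupling (lazy_walk e a i) (lazy_walk e a j) pi ->
    \sum_x \sum_y pi x y * (dist x y)%:R
    = 1 + 2 * (1 - a) * (1 - (deg i)^-1 - (deg j)^-1) + 2 * pi i j.
  by move=> cpi; rewrite (coupling_cost eij cpi) !lazy_walk_mean_dist //; ring.
have [pi cpi pi_ij] : exists2 pi,
    coupling (lazy_walk e a i) (lazy_walk e a j) pi & pi i j = 0.
  apply: coupling_avoiding_cell.
  - by move=> y; apply: lazy_walk_ge0.
  - by move=> x; apply: lazy_walk_ge0.
  - exact: lazy_walk_total eij.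
  - exact: lazy_walk_total eji.
  - by rewrite lazy_walk_edge //; have := mass_gt0 _ _ eji; lra.
  - by rewrite lazy_walk_edge //; have := mass_gt0 _ _ eij; lra.
  - by rewrite !lazy_walk_edge.
apply/eqP; rewrite eq_le; apply/andP; split.
  apply: ge_inf; last by exists pi => //; rewrite cost // pi_ij mulr0 addr0.
  exists 0 => _ [pi' [pi0 _ _] ->].
  by apply: sumr_ge0 => x _; apply: sumr_ge0 => y _; rewrite mulr_ge0.
apply: lb_le_inf; first by eexists; exists pi.
move=> _ [pi' cpi' ->]; rewrite cost // lerDl mulr_ge0 //.
by case: cpi'.
Qed.

Lemma ollivier_ricci_tree (a : R) (i j : 'I_n) :
  e i j -> 0 <= a < 1 -> (deg i)^-1 + (deg j)^-1 <= (1 - a)^-1 ->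
  ollivier_ricci e a i j = (1 - a) * (2 * ((deg i)^-1 + (deg j)^-1 - 1)).
Proof.
move=> eij a01 lazy; rewrite /ollivier_ricci wasserstein1_lazy_walk //.
by rewrite (tree_dist_edge e_tree eij) divr1; ring.
Qed.

Lemma laziness_half (a : R) (i j : 'I_n) :
  2^-1 <= a -> a < 1 -> (deg i)^-1 + (deg j)^-1 <= (1 - a)^-1.
Proof.
move=> a_half a1.
have inv_le1 x : (deg x)^-1 <= 1.
  case: (degree e x) => [|d]; first by rewrite invr0.
  by rewrite invf_le1 ?ltr0n // ler1n.
apply: (@le_trans _ _ 2); first by have := inv_le1 i; have := inv_le1 j; lra.
by rewrite -[2]invrK lef_pV2 ?posrE //; lra.
Qed.

Lemma lin_lu_yau_quotient_near (i j : 'I_n) :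
  e i j ->
  \forall a \near (1 : R)^'-,
    lin_lu_yau_quotient e i j a = 2 * ((deg i)^-1 + (deg j)^-1 - 1).
Proof.
move=> eij; near=> a.
have a1 : a < 1 by near: a; exact: nbhs_left_lt.
have a_half : 2^-1 <= a by near: a; apply: nbhs_left_ge; lra.
rewrite /lin_lu_yau_quotient ollivier_ricci_tree //; last 2 first.
- by rewrite a1 andbT; lra.
- exact: laziness_half.
by rewrite mulrC mulKf //; lra.
Unshelve. all: by end_near. Qed.

End LazyWalks.

(** * Comparison of the curvatures *)

Theorem theorem1p1 (R : realType) (n : nat) (e : rel 'I_n) (i j : 'I_n)
    (alpha : R) :
  (2 <= n)%N -> is_tree e -> e i j -> 0 <= alpha < 1 ->
  let laziness_condition :=
    (degree e i)%:R^-1 + (degree e j)%:R^-1 <= (1 - alpha)^-1 in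
  (2^-1 <= alpha -> laziness_condition) /\
  (laziness_condition ->
   [/\ cvg (lin_lu_yau_quotient (R := R) e i j a @[a --> 1^'-]),
       ollivier_ricci e alpha i j = (1 - alpha) * lin_lu_yau R e i j
     & (1 - alpha) * lin_lu_yau R e i j =
       (1 - alpha) * ((n%:R - 1) / n%:R) *
       (steinerberger R e i 0 / (degree e i)%:R
        + steinerberger R e j 0 / (degree e j)%:R)]).
Proof.
move=> n2 e_tree eij alpha01 lazy_cond.
have eji : e j i by rewrite (tree_sym e_tree).
split=> [half|lazy].
  by case/andP: alpha01 => _ alpha1; apply: laziness_half.
have near_cst := lin_lu_yau_quotient_near R e_tree eij.
have lly : lin_lu_yau R e i j
    = 2 * ((degree e i)%:R^-1 + (degree e j)%:R^-1 - 1).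
  exact: lim_near_cst near_cst.
split; first exact: is_cvg_near_cst near_cst.
  by rewrite lly; apply: ollivier_ricci_tree.
rewrite lly !steinerberger_tree //.
have deg_neq0 x y : e x y -> (degree e x)%:R != 0 :> R.
  by move=> exy; rewrite pnatr_eq0 -lt0n (degree_gt0 exy).
field; rewrite (deg_neq0 _ _ eij) (deg_neq0 _ _ eji) /=.
by rewrite subr_eq0 -[1]/(1%:R) eqr_nat pnatr_eq0 !gtn_eqF // (ltn_trans _ n2).
Qed.
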